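(* Suppose there is $0\le L_g<\infty$ with $\|\mathbf g(\mathbf x)-\mathbf g(\mathbf y)\|\le L_g\|\mathbf x-\mathbf y\|$ for all $\mathbf x,\mathbf y\in\mathbb R^d_+$. Let $\mathbf x_*$ be a local minimum of $f$ subject to $\mathbf x\ge\mathbf 0$ with $\mathcal I(\mathbf x_*,0)\neq\emptyset$ which is non-degenerate, i.e. $[\mathbf g(\mathbf x_* )]^i>0$ for all $i\in\mathcal A(\mathbf x_*,0)$, and satisfies the second-order sufficiency condition $\langle\mathbf z,\mathbf H(\mathbf x_* )\mathbf z\rangle>0$ for all $\mathbf z\ne\mathbf 0$ with $\mathbf z^i=0$ for $i\in\mathcal A(\mathbf x_*,0)$. Let $\delta$ satisfy $0<\delta<\frac12\min_{i\in\mathcal I(\mathbf x_*,0)}\mathbf x_*^i$, and let $\{\mathbf x_k\}$ be the sequence of iterates generated by the local phase algorithm (defined in the context) with $\delta_k=\delta$. Then there exists $\Delta_{\mathrm{actv}}>0$ such that if $\mathbf x_{\bar k}\in B(\mathbf x_*,\Delta_{\mathrm{actv}})$, then $\mathcal A(\mathbf x_k,\delta)=\mathcal A(\mathbf x_k,0)=\mathcal A(\mathbf x_*,0)$ for all $k\ge\bar k+1$.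
   Context: **Notation.** $f:\mathbb R^d\to\mathbb R$ is twice continuously differentiable. $\mathbb R^d_+=\{\mathbf x:\mathbf x\ge \mathbf 0\}$, $\mathbf g=\nabla f$, $\mathbf H=\nabla^2 f$, $[\mathcal P(\mathbf x)]^i=\max\{\mathbf x^i,0\}$, $B(\mathbf x,r)=\{\mathbf z:\|\mathbf z-\mathbf x\|<r\}$. For $\mathbf x\in\mathbb R^d_+$, $\delta\ge0$: $\mathcal A(\mathbf x,\delta)=\{i:0\le \mathbf x^i\le\delta\}$, $\mathcal I(\mathbf x,\delta)=\{i:\mathbf x^i>\delta\}$. For an index set $S$, $\mathbf v^S$ is the subvector and $\mathbf H^S$ the principal submatrix indexed by $S$. Subscript $k$ means evaluation at $\mathbf x_k$; superscripts $\mathcal A,\mathcal I$ at iteration $k$ refer to $\mathcal A(\mathbf x_k,\delta)$, $\mathcal I(\mathbf x_k,\delta)$. Terms over empty index sets are $0$. **MINRES$(\mathbf B,\mathbf b,\eta,0)$.** For symmetric $\mathbf B\in\mathbb R^{n\times n}$, $\mathbf b\in\mathbb R^n$, let $\mathcal K_t(\mathbf B,\mathbf b)=\mathrm{Span}\{\mathbf b,\dots,\mathbf B^{t-1}\mathbf b\}$, $\mathbf s^{(0)}=\mathbf 0$, $\mathbf s^{(t)}=\arg\min_{\mathbf s\in\mathcal K_t(\mathbf B,\mathbf b)}\|\mathbf B\mathbf s+\mathbf b\|^2$, $\mathbf r^{(t)}=-\mathbf B\mathbf s^{(t)}-\mathbf b$. For $t=1,2,\dots$: if $\mathbf r^{(t-1)}\ne\mathbf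 0$ and $\langle\mathbf r^{(t-1)},\mathbf B\mathbf r^{(t-1)}\rangle\le0$, stop and return $\mathbf r^{(t-1)}$ (type NPC); otherwise, if $\|\mathbf B\mathbf r^{(t-1)}\|\le\eta\|\mathbf B\mathbf s^{(t-1)}\|$, stop and return $\mathbf s^{(t-1)}$ (type SOL); otherwise continue. **Local phase algorithm** (no outer termination imposed). Parameters $\mathbf x_0\ge\mathbf 0$, $\rho\in(0,1/2)$, $\zeta\in(0,1)$, inexactness tolerances $\eta=\eta_k>0$. For $k=0,1,\dots$: $\mathbf p_k^{\mathcal A}=-\mathbf g_k^{\mathcal A}$; $\mathbf p_k^{\mathcal I}$ is the output of $\mathrm{MINRES}(\mathbf H_k^{\mathcal I},\mathbf g_k^{\mathcal I},\eta,0)$; $\alpha_k$ is the first element of $1,\zeta,\zeta^2,\dots$ such that $\alpha=\alpha_k$ satisfies $$f(\mathcal P(\mathbf x_k+\alpha\mathbf p_k))-f(\mathbf x_k)\le\rho\langle\mathbf g_k^{\mathcal A},\mathcal P(\mathbf x_k^{\mathcal A}+\alpha\mathbf p_k^{\mathcal A})-\mathbf x_k^{\mathcal A}\rangle+\alpha\rho\langle\mathbf g_k^{\mathcal I},\mathbf p_k^{\mathcal I}\rangle;$$ $\mathbf x_{k+1}=\mathcal P(\mathbf x_k+\alpha_k\mathbf p_k)$. *)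

(* Defs.v *)
From mathcomp Require Import all_boot all_order all_algebra.
From mathcomp Require Import all_classical all_reals all_analysis.
Set Implicit Arguments.
Unset Strict Implicit.
Unset Printing Implicit Defensive.
Import Order.TTheory GRing.Theory Num.Theory.
Import numFieldNormedType.Exports.
Local Open Scope classical_set_scope.
Local Open Scope ring_scope.

Definition dotv (R : realType) (n : nat) (u v : 'cV[R]_n) : R :=
  \sum_(i < n) u i 0 * v i 0.

(* The library norm `|v| on 'cV[R]_n is the sup norm; this is the Euclidean
   one. *)
Definition norm2 (R : realType) (n : nat) (v : 'cV[R]_n) : R :=
  Num.sqrt (dotv v v).

Definition ball2 (R : realType) (n : nat) (x : 'cV[R]_n) (r : R) :
  set 'cV[R]_n := [set z | norm2 (z - x) < r].

Definition orthant (R : realType) (n : nat) : set 'cV[R]_n :=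
  [set x | forall i, 0 <= x i 0].

Definition proj_orthant (R : realType) (n : nat) (x : 'cV[R]_n) : 'cV[R]_n :=
  \col_i Num.max (x i 0) 0.

Definition grad (R : realType) (d : nat) (f : 'cV[R]_d -> R) (x : 'cV[R]_d) :
  'cV[R]_d := \col_i 'D_(delta_mx i 0) f x.

Definition hess (R : realType) (d : nat) (f : 'cV[R]_d -> R) (x : 'cV[R]_d) :
  'M[R]_d := \matrix_(i, j) 'D_(delta_mx j 0) (fun y => grad f y i 0) x.

(* The derivative operators used in grad and hess are total, so the
   differentiability (in the Frechet sense) has to be required as well. *)
Definition twice_continuously_differentiable (R : realType) (d : nat)
    (f : 'cV[R]_d -> R) : Prop :=
  [/\ forall x, differentiable f x,
      forall x, differentiable (grad f) x &
      continuous (hess f)].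

Definition active (R : realType) (d : nat) (x : 'cV[R]_d) (delta : R) :
  {set 'I_d} := [set i | 0 <= x i 0 <= delta]%SET.

Definition inactive (R : realType) (d : nat) (x : 'cV[R]_d) (delta : R) :
  {set 'I_d} := [set i | delta < x i 0]%SET.

(* The indices in S are taken in the order of enum S. *)
Definition subvec (R : realType) (d : nat) (S : {set 'I_d}) (v : 'cV[R]_d) :
  'cV[R]_#|S| := \col_i v (enum_val i) 0.

Definition principal_submx (R : realType) (d : nat) (S : {set 'I_d})
    (H : 'M[R]_d) : 'M[R]_#|S| := \matrix_(i, j) H (enum_val i) (enum_val j).

Definition krylov (R : realType) (n : nat) (B : 'M[R]_n) (b : 'cV[R]_n)
    (t : nat) : {vspace 'cV[R]_n} :=
  <<[seq B ^+ i *m b | i <- iota 0 t]>>%VS.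

Definition minres_iterate (R : realType) (n : nat) (B : 'M[R]_n)
    (b : 'cV[R]_n) (t : nat) (s : 'cV[R]_n) : Prop :=
  s \in krylov B b t /\
  forall s', s' \in krylov B b t ->
    norm2 (B *m s + b) ^+ 2 <= norm2 (B *m s' + b) ^+ 2.

Definition minres_residual (R : realType) (n : nat) (B : 'M[R]_n)
    (b s : 'cV[R]_n) : 'cV[R]_n := - (B *m s) - b.

Inductive minres_type := NPC | SOL.

Definition npc_test (R : realType) (n : nat) (B : 'M[R]_n) (r : 'cV[R]_n) :
  bool := (r != 0) && (dotv r (B *m r) <= 0).

Definition sol_test (R : realType) (n : nat) (B : 'M[R]_n) (eta : R)
    (s r : 'cV[R]_n) : bool := norm2 (B *m r) <= eta * norm2 (B *m s).

(* minres B b eta ty p: MINRES(B, b, eta, 0) stops and returns p, of type ty.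
   The sequence s consists of the Krylov minimizers, with s 0 = 0 because
   krylov B b 0 is the zero space; the index t below is one less than the loop
   counter of the algorithm, which starts at 1. *)
Definition minres (R : realType) (n : nat) (B : 'M[R]_n) (b : 'cV[R]_n)
    (eta : R) (ty : minres_type) (p : 'cV[R]_n) : Prop :=
  exists s : nat -> 'cV[R]_n,
    let r t := minres_residual B b (s t) in
    (forall t, minres_iterate B b t (s t)) /\
    exists t : nat,
      (forall u, (u < t)%N ->
         ~~ npc_test B (r u) /\ ~~ sol_test B eta (s u) (r u)) /\
      match ty with
      | NPC => npc_test B (r t) /\ p = r t
      | SOL => [/\ ~~ npc_test B (r t), sol_test B eta (s t) (r t) & p = s t]
      end.

Definition line_search_cond (R : realType) (d : nat) (f : 'cV[R]_d -> R)
    (rho delta : R) (x p : 'cV[R]_d) (alpha : R) : bool :=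
  let A := active x delta in
  let I := inactive x delta in
  let g := grad f x in
  f (proj_orthant (x + alpha *: p)) - f x <=
    rho * dotv (subvec A g)
      (proj_orthant (subvec A x + alpha *: subvec A p) - subvec A x) +
    alpha * rho * dotv (subvec I g) (subvec I p).

Definition local_direction (R : realType) (d : nat) (f : 'cV[R]_d -> R)
    (eta delta : R) (x p : 'cV[R]_d) : Prop :=
  let A := active x delta in
  let I := inactive x delta in
  subvec A p = - subvec A (grad f x) /\
  exists ty, minres (principal_submx I (hess f x)) (subvec I (grad f x)) eta
                    ty (subvec I p).

Definition local_step (R : realType) (d : nat) (f : 'cV[R]_d -> R)
    (rho zeta eta delta : R) (x x' : 'cV[R]_d) : Prop :=
  exists p : 'cV[R]_d, exists j : nat,
    [/\ local_direction f eta delta x p,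
        line_search_cond f rho delta x p (zeta ^+ j),
        forall l, (l < j)%N -> ~~ line_search_cond f rho delta x p (zeta ^+ l) &
        x' = proj_orthant (x + zeta ^+ j *: p)].

Definition local_phase (R : realType) (d : nat) (f : 'cV[R]_d -> R)
    (rho zeta : R) (eta : nat -> R) (delta : R) (x : nat -> 'cV[R]_d) : Prop :=
  orthant (x 0%N) /\
  forall k, local_step f rho zeta (eta k) delta (x k) (x k.+1).

Definition constrained_local_min (R : realType) (d : nat) (f : 'cV[R]_d -> R)
    (xs : 'cV[R]_d) : Prop :=
  orthant xs /\
  exists2 e : R, 0 < e &
    forall x, orthant x -> ball2 xs e x -> f xs <= f x.

(* Main.v *)
Require Import Defs.
From mathcomp Require Import all_boot all_order all_algebra.
From mathcomp Require Import all_classical all_reals all_analysis.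
From mathcomp Require Import ring lra.
Import Order.TTheory GRing.Theory Num.Theory.
Import numFieldNormedType.Exports.
Set Implicit Arguments.
Unset Strict Implicit.
Unset Printing Implicit Defensive.
Local Open Scope ring_scope.

(** For x in the orthant near xs, the active set with threshold delta is the
    active set A of xs (active_near), and on A the gradient is bounded below by
    some c > 0 (grad_active_near). The step on A is therefore the projected
    gradient step max (x_i - alpha g_i) 0, which vanishes as soon as
    x_i <= alpha c. So one step from a small enough ball identifies A, provided
    that alpha has a positive lower bound, and it remains to show that all later
    iterates stay in the ball.

    Both points rest on the direction p computed on the inactive block. The
    Hessian is uniformly positive there (uniform_positivity, hess_positive_near),
    so MINRES never detects nonpositive curvature and returns one of its iterates.
    Each iterate is a convex combination of the previous one and of the conjugate
    gradient iterate, hence keeps the quadratic model nonpositive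
    (minres_energy_le0). This yields - <g, p> >= (mu / 2) |p| ^ 2, whatever
    the inexactness tolerance and the number of inner iterations. Consequently
    the line search accepts all steps below a threshold that depends only on L, mu
    and rho (line_search_cond_small), and |p| is O(|x - xs|), because the gradient
    vanishes at xs off A (stationary_off_active).

    For the stability, f grows quadratically around xs on the orthant
    (quadratic_growth). Since |x' - xs| = O(|x - xs|), a step from a small ball
    lands where growth holds, and since f does not increase, the set
    {|x - xs| < r, f x - f xs < m r ^ 2} is mapped into itself
    (identifying_neighbourhood). It contains a ball around xs. *)

(** * Euclidean inner product and positive quadratic forms *)

Section DotProduct.
Variable R : realType.

Lemma dotvE n (u v : 'cV[R]_n) : dotv u v = (u^T *m v) 0 0.
Proof. by rewrite /dotv mxE; apply: eq_bigr => i _; rewrite mxE. Qed.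

Lemma dotvC n (u v : 'cV[R]_n) : dotv u v = dotv v u.
Proof. by apply: eq_bigr => i _; rewrite mulrC. Qed.

Lemma dotvDr n (u v w : 'cV[R]_n) : dotv u (v + w) = dotv u v + dotv u w.
Proof. by rewrite !dotvE mulmxDr mxE. Qed.

Lemma dotvDl n (u v w : 'cV[R]_n) : dotv (v + w) u = dotv v u + dotv w u.
Proof. by rewrite dotvC dotvDr !(dotvC u). Qed.

Lemma dotvZr n a (u v : 'cV[R]_n) : dotv u (a *: v) = a * dotv u v.
Proof. by rewrite !dotvE -scalemxAr mxE. Qed.

Lemma dotvZl n a (u v : 'cV[R]_n) : dotv (a *: u) v = a * dotv u v.
Proof. by rewrite dotvC dotvZr dotvC. Qed.

Lemma dotvNr n (u v : 'cV[R]_n) : dotv u (- v) = - dotv u v.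
Proof. by rewrite -scaleN1r dotvZr mulN1r. Qed.

Lemma dotvNl n (u v : 'cV[R]_n) : dotv (- u) v = - dotv u v.
Proof. by rewrite dotvC dotvNr dotvC. Qed.

Lemma dotvBr n (u v w : 'cV[R]_n) : dotv u (v - w) = dotv u v - dotv u w.
Proof. by rewrite dotvDr dotvNr. Qed.

Lemma dotvBl n (u v w : 'cV[R]_n) : dotv (v - w) u = dotv v u - dotv w u.
Proof. by rewrite dotvDl dotvNl. Qed.

Lemma dotv0r n (u : 'cV[R]_n) : dotv u 0 = 0.
Proof. by rewrite dotvE mulmx0 mxE. Qed.

Lemma dotv0l n (u : 'cV[R]_n) : dotv 0 u = 0.
Proof. by rewrite dotvC dotv0r. Qed.

Lemma dotv_delta n (u : 'cV[R]_n) i : dotv (delta_mx i 0) u = u i 0.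
Proof.
rewrite /dotv (bigD1 i) //= big1 ?addr0 => [|j ji]; rewrite mxE ?eqxx ?mul1r //.
by rewrite (negbTE ji) mul0r.
Qed.

Lemma dotv_ge0 n (v : 'cV[R]_n) : 0 <= dotv v v.
Proof. by apply: sumr_ge0 => i _; rewrite -expr2 sqr_ge0. Qed.

Lemma sqr_le_dotv n (v : 'cV[R]_n) i : v i 0 ^+ 2 <= dotv v v.
Proof.
rewrite /dotv (bigD1 i) //= -expr2 lerDl.
by apply: sumr_ge0 => j _; rewrite -expr2 sqr_ge0.
Qed.

Lemma dotv_eq0 n (v : 'cV[R]_n) : dotv v v = 0 -> v = 0.
Proof.
move=> v0; apply/colP => i; rewrite mxE; apply/eqP.
by rewrite -sqrf_eq0 eq_le sqr_ge0 -v0 sqr_le_dotv.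
Qed.

Lemma dotv_gt0 n (v : 'cV[R]_n) : v <> 0 -> 0 < dotv v v.
Proof.
by move=> v0; rewrite lt_neqAle dotv_ge0 andbT eq_sym; apply/eqP => /dotv_eq0.
Qed.

Lemma sqr_norm2 n (v : 'cV[R]_n) : norm2 v ^+ 2 = dotv v v.
Proof. by rewrite /norm2 sqr_sqrtr // dotv_ge0. Qed.

Lemma norm2_ge0 n (v : 'cV[R]_n) : 0 <= norm2 v.
Proof. exact: sqrtr_ge0. Qed.

Lemma norm2_lt n (v : 'cV[R]_n) r :
  0 < r -> (norm2 v < r) = (dotv v v < r ^+ 2).
Proof.
by move=> r0; rewrite -sqr_norm2 ltr_pXn2r // nnegrE ?norm2_ge0 ?ltW.
Qed.

Lemma dotv_mulmxr n (B : 'M[R]_n) u v : B^T = B ->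
  dotv u (B *m v) = dotv v (B *m u).
Proof.
move=> symB; rewrite [RHS]dotvC !dotvE trmx_mul symB.
by rewrite mulmxA.
Qed.

(** The discriminant argument. Positivity is asked only on the line through u in
    direction v, so that the inequality serves forms that are positive on a
    subspace. *)
Lemma cauchy_schwarz_form n (B : 'M[R]_n) (u v : 'cV[R]_n) : B^T = B ->
  (forall a, 0 <= dotv (u + a *: v) (B *m (u + a *: v))) ->
  0 < dotv v (B *m v) ->
  dotv u (B *m v) ^+ 2 <= dotv u (B *m u) * dotv v (B *m v).
Proof.
move=> symB pos vv.
have := pos (- dotv u (B *m v) / dotv v (B *m v)).
rewrite mulmxDr -scalemxAr !(dotvDr, dotvDl, dotvZr, dotvZl).
rewrite (dotv_mulmxr v u symB).
set x := dotv u _; set y := dotv v _ in vv *; set z := dotv u _.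
move=> H; rewrite -subr_ge0.
have -> : x * y - z ^+ 2
  = y * (x + - z / y * z + - z / y * (z + - z / y * y)).
  by field; rewrite gt_eqF.
by rewrite mulr_ge0 // ltW.
Qed.

Lemma cauchy_schwarz n (u v : 'cV[R]_n) :
  dotv u v ^+ 2 <= dotv u u * dotv v v.
Proof.
have [->|/eqP v0] := eqVneq v 0; first by rewrite !dotv0r expr0n mulr0.
have := @cauchy_schwarz_form n 1%:M u v (trmx1 _ _).
by rewrite !mul1mx; apply => [a|]; rewrite ?mul1mx ?dotv_ge0 ?dotv_gt0.
Qed.

Lemma dotv_le_norm2 n (u v : 'cV[R]_n) : dotv u v <= norm2 u * norm2 v.
Proof.
apply: le_trans (ler_norm _) _; rewrite -(@ler_pXn2r _ 2) ?nnegrE //;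
  rewrite ?mulr_ge0 ?norm2_ge0 //.
by rewrite real_normK ?num_real // exprMn !sqr_norm2 cauchy_schwarz.
Qed.

End DotProduct.

Section Galerkin.
Variable R : realType.

(** Conjugate directions: induction on the generators. When x is adjoined, the
    previous solution is corrected along y, the part of x that is B-orthogonal
    to the old span, so the equations already solved are not disturbed; y itself
    comes from the induction hypothesis with right-hand side B x. *)
Lemma galerkin_solution n (B : 'M[R]_n) (X : seq 'cV[R]_n) (b : 'cV[R]_n) :
  (forall z, z \in <<X>>%VS -> z <> 0 -> 0 < dotv z (B *m z)) -> B^T = B ->
  exists2 c, c \in <<X>>%VS &
    forall v, v \in <<X>>%VS -> dotv v (B *m c + b) = 0.
Proof.
move=> + symB; elim: X b => [b _|x X IH b posB].
  exists 0; first exact: mem0v.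
  by move=> v; rewrite span_nil memv0 => /eqP->; rewrite dotv0l.
have sub : (<<X>> <= <<x :: X>>)%VS by rewrite span_cons addvSr.
have xin : x \in <<x :: X>>%VS by rewrite memv_span // mem_head.
have IHX := IH _ (fun z zX => posB z (subvP sub _ zX)).
have [c0 c0X c0b] := IHX b.
have [w wX wb] := IHX (B *m x).
pose y := x + w; have yin : y \in <<x :: X>>%VS by rewrite memvD // (subvP sub).
have yort v : v \in <<X>>%VS -> dotv v (B *m y) = 0.
  by move=> /wb; rewrite -mulmxDr addrC.
have dec v : v \in <<x :: X>>%VS ->
    exists a, exists2 v', v' \in <<X>>%VS & v = a *: y + v'.
  rewrite span_cons => /memv_addP[_ /vlineP[a ->]] [v' v'X ->].
  exists a, (v' - a *: w); first by rewrite memvB // memvZ.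
  by rewrite /y scalerDr -addrA (addrC (a *: w)) subrK.
have [y0|/eqP y0] := eqVneq y 0.
  exists c0; first exact: (subvP sub).
  by move=> v /dec[a [v' v'X ->]]; rewrite y0 scaler0 add0r c0b.
have yy := posB y yin y0.
pose t := - dotv y (B *m c0 + b) / dotv y (B *m y).
exists (c0 + t *: y); first by rewrite memvD ?memvZ // (subvP sub).
move=> v /dec[a [v' v'X ->]].
have -> : B *m (c0 + t *: y) + b = (B *m c0 + b) + t *: (B *m y).
  by rewrite mulmxDr -scalemxAr addrAC.
rewrite dotvDl dotvZl !(dotvDr _ (B *m c0 + b)) !dotvZr (c0b v') // (yort v') //.
by rewrite mulr0 !addr0 /t mulfVK ?gt_eqF // subrr mulr0.
Qed.

(** The constant is read off the trace of the inverse of the form: if c_i solves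
    <B c_i, v> = v_i for all v supported in I, then the Cauchy-Schwarz inequality
    of the form bounds z_i ^ 2 = <B c_i, z> ^ 2 by <c_i, B c_i> <z, B z>; sum
    over i. *)
Lemma uniform_positivity n (B : 'M[R]_n) (I : {set 'I_n}) : B^T = B ->
  (forall z : 'cV[R]_n, z <> 0 -> (forall i, i \notin I -> z i 0 = 0) ->
     0 < dotv z (B *m z)) ->
  exists2 mu, 0 < mu & forall z : 'cV[R]_n,
    (forall i, i \notin I -> z i 0 = 0) -> mu * dotv z z <= dotv z (B *m z).
Proof.
move=> symB posB.
pose X : seq 'cV[R]_n := [seq delta_mx i 0 | i <- enum I].
have spanX z : (z \in <<X>>%VS) <-> forall i, i \notin I -> z i 0 = 0.
  split=> [/coord_span -> i iI|z0].
    rewrite summxE big1 // => k _; rewrite mxE.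
    have kI : (k < size (enum I))%N by rewrite -cardE.
    rewrite (nth_map i) // mxE.
    case: eqP => [e|_]; last by rewrite mulr0.
    by case/negP: iI; rewrite e -mem_enum mem_nth.
  rewrite (_ : z = \sum_i z i 0 *: delta_mx i 0); last first.
    by rewrite {1}[z]matrix_sum_delta; apply: eq_bigr => i _; rewrite big_ord1.
  apply: memv_suml => i _; have [iI|iI] := boolP (i \in I).
    by apply/memvZ/memv_span/map_f; rewrite mem_enum.
  by rewrite z0 // scale0r mem0v.
have posX z : z \in <<X>>%VS -> z <> 0 -> 0 < dotv z (B *m z).
  by move=> /spanX zI z0; apply: posB.
have posX0 z : z \in <<X>>%VS -> 0 <= dotv z (B *m z).
  move=> zX; have [->|/eqP z0] := eqVneq z 0; first by rewrite dotv0l.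
  exact/ltW/posX.
have [i|c cP] := @choice _ _ (fun i ci => ci \in <<X>>%VS /\
    forall v, v \in <<X>>%VS -> dotv v (B *m ci) = v i 0).
  have [c cX cP] := galerkin_solution (- delta_mx i 0) posX symB.
  exists c; split=> // v /cP /eqP.
  by rewrite dotvDr dotvNr subr_eq0 => /eqP->; rewrite dotvC dotv_delta.
(* The summand 1 keeps the constant invertible when I is empty. *)
pose T := 1 + \sum_i dotv (c i) (B *m c i).
have T0 : 0 < T.
  by rewrite ltr_pwDl // sumr_ge0 // => i _; rewrite posX0 //; case: (cP i).
exists T^-1; first by rewrite invr_gt0.
move=> z /spanX zX.
have [->|/eqP z0] := eqVneq z 0; first by rewrite !dotv0l mulr0.
rewrite ler_pdivrMl // /T mulrDl mul1r mulr_suml ler_wpDl ?posX0 //.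
apply: ler_sum => i _; have [ciX ciP] := cP i.
rewrite -expr2 -(ciP z) // (dotv_mulmxr _ _ symB).
apply: cauchy_schwarz_form => // [a|]; last exact: posX.
by rewrite posX0 // memvD // memvZ.
Qed.

End Galerkin.

(** * Descent of the minimal residual iterates *)

Section Minres.
Variable R : realType.

Lemma krylovS n (B : 'M[R]_n) b t :
  krylov B b t.+1 = (krylov B b t + <[B ^+ t *m b]>)%VS.
Proof. by rewrite /krylov -[t.+1]addn1 iotaD map_cat span_cat span_seq1. Qed.

Lemma krylov_subS n (B : 'M[R]_n) b t : (krylov B b t <= krylov B b t.+1)%VS.
Proof. by rewrite krylovS addvSl. Qed.

Lemma mem_krylovS n (B : 'M[R]_n) b t : b \in krylov B b t.+1.
Proof. by apply: memv_span; rewrite /= expr0 mul1mx mem_head. Qed.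

Lemma mulmx_krylov n (B : 'M[R]_n) b t v :
  v \in krylov B b t -> B *m v \in krylov B b t.+1.
Proof.
elim: t v => [v|t IH v].
  by rewrite /krylov span_nil memv0 => /eqP->; rewrite mulmx0 mem0v.
rewrite krylovS => /memv_addP[k kt [_ /vlineP[a ->]] ->].
rewrite mulmxDr -scalemxAr mulmxA -[B *m B ^+ t]exprS.
rewrite krylovS memv_add ?IH // memvZ // memv_line //.
Qed.

(** The dimension grows by at most one, so any new vector e completes the old
    space. *)
Lemma krylovS_direction n (B : 'M[R]_n) b t e v :
  e \in krylov B b t.+1 -> e \notin krylov B b t -> v \in krylov B b t.+1 ->
  exists a, v - a *: e \in krylov B b t.
Proof.
rewrite krylovS => /memv_addP[k kt [_ /vlineP[a ->]] ->].
have [->|a0] := eqVneq a 0; first by rewrite scale0r addr0 kt.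
move=> _ /memv_addP[k' k't [_ /vlineP[a' ->]] ->].
exists (a' / a); rewrite scalerDr scalerA divfK // opprD addrACA subrr addr0.
by rewrite memvB // memvZ.
Qed.

(** The normal equations of the least squares problem, obtained by perturbing the
    minimizer by a multiple of v. *)
Lemma minres_orthogonal n (B : 'M[R]_n) b t s : minres_iterate B b t s ->
  forall v, v \in krylov B b t -> dotv (B *m v) (B *m s + b) = 0.
Proof.
move=> [sK smin] v vK.
set x := dotv _ _; pose y := dotv (B *m v) (B *m v).
have y0 : 0 <= y by apply: dotv_ge0.
have quad a : 0 <= a * (2 * x) + a ^+ 2 * y.
  have := smin (s + a *: v); rewrite !sqr_norm2 mulmxDr -scalemxAr addrAC.
  rewrite memvD ?memvZ // => /(_ isT).
  rewrite !(dotvDl _ _ (a *: _)) !(dotvDr _ _ (a *: _)) !dotvZl !dotvZr.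
  rewrite (dotvC (B *m s + b) (B *m v)) -/x -/y -subr_ge0; congr (0 <= _); ring.
have y1 : 0 < y + 1 by rewrite ltr_wpDl.
have := quad (- x / (y + 1)).
have -> : - x / (y + 1) * (2 * x) + (- x / (y + 1)) ^+ 2 * y
   = - (x ^+ 2 * (y + 2) / (y + 1) ^+ 2) by field; rewrite gt_eqF.
rewrite oppr_ge0 pmulr_lle0 ?invr_gt0 ?exprn_gt0 // pmulr_lle0 ?ltr_wpDl //.
by move=> x0; apply/eqP; rewrite -sqrf_eq0 eq_le x0 sqr_ge0.
Qed.

Section PositiveDefinite.
Variables (n : nat) (B : 'M[R]_n) (b : 'cV[R]_n).
Hypothesis symB : B^T = B.
Hypothesis posB : forall z : 'cV[R]_n, z <> 0 -> 0 < dotv z (B *m z).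

(** The quadratic model that conjugate gradients minimize; its gradient at s is
    B s + b. *)
Definition energy (s : 'cV[R]_n) : R := 2^-1 * dotv s (B *m s) + dotv b s.

Lemma form_ge0 (z : 'cV[R]_n) : 0 <= dotv z (B *m z).
Proof.
by have [->|/eqP/posB/ltW //] := eqVneq z 0; rewrite dotv0l.
Qed.

Lemma mulmx_pos_eq0 (z : 'cV[R]_n) : B *m z = 0 -> z = 0.
Proof.
move=> Bz; apply/eqP; case: eqP => // /posB.
by rewrite Bz dotv0r ltxx.
Qed.

Lemma minres_unique t s s' : minres_iterate B b t s ->
  s' \in krylov B b t ->
  (forall v, v \in krylov B b t -> dotv (B *m v) (B *m s' + b) = 0) -> s = s'.
Proof.
move=> sP s'K s'P; have [sK _] := sP.
apply/eqP; rewrite -subr_eq0; apply/eqP/mulmx_pos_eq0/dotv_eq0.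
have ssK : s - s' \in krylov B b t by rewrite memvB.
have -> : dotv (B *m (s - s')) (B *m (s - s')) =
  dotv (B *m (s - s')) (B *m s + b) - dotv (B *m (s - s')) (B *m s' + b).
  by rewrite -dotvBr opprD addrACA subrr addr0 -mulmxBr.
by rewrite s'P // (minres_orthogonal sP) // subrr.
Qed.

Lemma energy_convex tau s s' : 0 <= tau <= 1 ->
  energy ((1 - tau) *: s + tau *: s') <=
  (1 - tau) * energy s + tau * energy s'.
Proof.
move=> /andP[t0 t1]; rewrite -subr_ge0.
suff -> : (1 - tau) * energy s + tau * energy s' -
  energy ((1 - tau) *: s + tau *: s') =
  2^-1 * tau * (1 - tau) * dotv (s - s') (B *m (s - s')).
  by rewrite !mulr_ge0 ?form_ge0 ?subr_ge0 ?invr_ge0 ?ler0n.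
rewrite /energy mulmxDr mulmxBr -!scalemxAr.
rewrite !(dotvDl, dotvDr, dotvBl, dotvBr, dotvZl, dotvZr, dotvNr, dotvNl).
rewrite (dotv_mulmxr s' s symB); ring.
Qed.

(** Residual smoothing: the minimal residual iterate over the next Krylov space
    is a convex combination of the current one and of the conjugate gradient
    iterate c. The residual of c is orthogonal to the whole next space, hence to
    the current residual; so every combination of the two keeps the old normal
    equations, and the best one, with weight tau in [0, 1], also satisfies the
    equation for the direction c - m that enlarges the space. Both end points have
    nonpositive energy, and the energy is convex. *)
Lemma minres_energy_le0 (s : nat -> 'cV[R]_n) t :
  (forall t, minres_iterate B b t (s t)) -> energy (s t) <= 0.
Proof.
move=> sP; elim: t => [|t IH].
  have [+ _] := sP 0%N; rewrite /krylov span_nil memv0 => /eqP->.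
  by rewrite /energy dotv0l dotv0r mulr0 addr0.
have [c cK cP] := galerkin_solution b
  (fun z (_ : z \in krylov B b t.+1) => @posB z) symB.
have cE : energy c <= 0.
  have := cP c cK; rewrite dotvDr dotvC => /eqP; rewrite addr_eq0 => /eqP cb.
  rewrite /energy dotvC cb (dotvC b) (_ : _ + _ = - (2^-1 * - dotv c b)).
    by rewrite -cb dotvC oppr_le0 mulr_ge0 ?form_ge0 ?invr_ge0.
  by field.
have [mK _] := sP t; set m := s t in IH mK.
have mK' : m \in krylov B b t.+1 by apply: subvP (krylov_subS _ _ _) _ mK.
set rm := B *m m + b; set rc := B *m c + b.
have rmK : rm \in krylov B b t.+1 by rewrite memvD ?mulmx_krylov ?mem_krylovS.
(* If the direction is not new, then c is already the exact solution. *)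
have [ecK|ecK] := boolP (c - m \in krylov B b t).
  have cK' : c \in krylov B b t by rewrite -(subrK m c) memvD.
  have rc0 : rc = 0.
    by apply/dotv_eq0/cP; rewrite memvD ?mulmx_krylov ?mem_krylovS.
  rewrite (minres_unique (sP t.+1) cK) // => v _.
  by rewrite -/rc rc0 dotv0r.
have dr : rm - rc = - (B *m (c - m)).
  by rewrite /rm /rc opprD addrACA subrr addr0 mulmxBr opprB.
pose M := dotv rm rm; pose C := dotv rc rc.
have M0 : 0 <= M by apply: dotv_ge0.
have C0 : 0 <= C by apply: dotv_ge0.
have MC0 : 0 < M + C.
  rewrite lt_neqAle addr_ge0 // andbT eq_sym paddr_eq0 //.
  apply/negP => /andP[/eqP/dotv_eq0 m0 /eqP/dotv_eq0 c0].
  move: dr; rewrite m0 c0 subrr => /esym/eqP; rewrite oppr_eq0 => /eqP.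
  by move=> /mulmx_pos_eq0 cm0; rewrite cm0 mem0v in ecK.
(* The minimizer of |(1 - tau) rm + tau rc| for orthogonal rm and rc. *)
pose tau := M / (M + C).
have tauP : 0 <= tau <= 1.
  by rewrite divr_ge0 ?(ltW MC0) //= ler_pdivrMr // mul1r lerDl.
rewrite (@minres_unique t.+1 _ ((1 - tau) *: m + tau *: c) (sP t.+1)).
- apply: le_trans (energy_convex _ _ tauP) _.
  have /andP[t0 t1] := tauP.
  by rewrite -(addr0 0) lerD // mulr_ge0_le0 // subr_ge0.
- by rewrite memvD // memvZ.
move=> v vK.
have -> : B *m ((1 - tau) *: m + tau *: c) + b = (1 - tau) *: rm + tau *: rc.
  rewrite mulmxDr -!scalemxAr /rm /rc !scalerDr addrACA -scalerDl.
  by rewrite subrK scale1r.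
have eK : c - m \in krylov B b t.+1 by rewrite memvB.
have [a kK] := krylovS_direction eK ecK vK.
rewrite -[v](subrK (a *: (c - m))); set k := v - _ in kK *.
rewrite mulmxDr dotvDl.
rewrite [X in X + _]dotvDr !dotvZr (minres_orthogonal (sP t)) //.
rewrite cP ?mulmx_krylov //.
rewrite !mulr0 addr0 add0r -scalemxAr dotvZl -[B *m (c - m)]opprK -dr.
have mc : dotv rm rc = 0 by apply: cP.
have expand (u w : 'cV[R]_n) : dotv u w = 0 -> dotv (- (u - w))
    ((1 - tau) *: u + tau *: w) = tau * dotv w w - (1 - tau) * dotv u u :> R.
  move=> uw; rewrite dotvNl !(dotvDr, dotvZr, dotvBl) (dotvC w u) uw; ring.
rewrite expand // -/M -/C /tau.
by field; rewrite gt_eqF.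
Qed.

End PositiveDefinite.

(** Positive curvature excludes the other return type, so the output is a
    Krylov minimizer, and nonpositive energy is exactly this bound. *)
Lemma minres_descent n (B : 'M[R]_n) b eta ty p (mu : R) : 0 < mu -> B^T = B ->
  (forall z : 'cV[R]_n, mu * dotv z z <= dotv z (B *m z)) ->
  minres B b eta ty p ->
  mu / 2 * dotv p p <= - dotv b p.
Proof.
move=> mu0 symB muB [s [sP [t [_]]]].
have posB (z : 'cV[R]_n) : z <> 0 -> 0 < dotv z (B *m z).
  by move=> z0; apply: lt_le_trans (muB z); rewrite mulr_gt0 ?dotv_gt0.
case: ty => [[/andP[/eqP r0 rle] _]|[_ _ ->]].
  by move: rle; rewrite leNgt posB.
have := minres_energy_le0 symB posB t sP; rewrite /energy.
have := muB (s t); lra.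
Qed.

(** Cauchy-Schwarz: a direction of quadratic descent is no longer than a multiple
    of the gradient b, so that steps are short near a stationary point. *)
Lemma descent_direction_bound n (b p : 'cV[R]_n) c : 0 < c ->
  c * dotv p p <= - dotv b p -> c ^+ 2 * dotv p p <= dotv b b.
Proof.
move=> c0 H; have p0 := dotv_ge0 p.
have [pz|pz] := eqVneq (dotv p p) 0; first by rewrite pz mulr0 dotv_ge0.
have pp : 0 < dotv p p by rewrite lt_neqAle eq_sym pz.
rewrite -(ler_pM2r pp); apply: le_trans (cauchy_schwarz b p).
rewrite -mulrA -expr2 -exprMn -[dotv b p ^+ 2]sqrrN ler_pXn2r //.
  by rewrite nnegrE mulr_ge0 // ltW.
by rewrite nnegrE; apply: le_trans H; rewrite mulr_ge0 // ltW.
Qed.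

End Minres.

(** * Differentiation along segments *)

Section Calculus.
Variables (R : realType) (d : nat).
Implicit Types (F f : 'cV[R]_d -> R) (x y v : 'cV[R]_d).

Lemma is_derive_line F x v t : differentiable F (x + t *: v) ->
  is_derive (t : R) (1 : R) (fun s : R => F (x + s *: v)) ('D_v F (x + t *: v)).
Proof.
move=> dF; have /= dv := @diff_derivable _ _ _ F _ v dF.
have E : (fun h : R => h^-1 *:
    (((fun s : R => F (x + s *: v)) \o shift t) (h *: 1) - F (x + t *: v))) =
  (fun h : R => h^-1 *: ((F \o shift (x + t *: v)) (h *: v) - F (x + t *: v))).
  apply/funext => h /=; congr (_ *: (F _ - _)).
  by rewrite [h *: 1]mulr1 scalerDl addrCA.
by split; [rewrite /derivable E|rewrite /derive E].
Qed.

Lemma derive_coord F x v : differentiable F x ->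
  'D_v F x = \sum_i v i 0 * 'D_(delta_mx i 0) F x.
Proof.
move=> dF; rewrite deriveE // {1}[v]matrix_sum_delta linear_sum.
apply: eq_bigr => i _; rewrite big_ord1 linearZ /=.
by rewrite deriveE.
Qed.

Lemma mulmx_delta (A : 'M[R]_d) i j : (A *m delta_mx j 0 : 'cV_d) i 0 = A i j.
Proof. by rewrite -colE mxE. Qed.

Lemma derive_grad f x v : differentiable f x -> 'D_v f x = dotv (grad f x) v.
Proof.
by move=> /derive_coord->; apply: eq_bigr => i _; rewrite mxE mulrC.
Qed.

Lemma MVT_unit (phi dphi : R -> R) :
  (forall t, is_derive t (1 : R) phi (dphi t)) ->
  exists2 c : R, 0 < c < 1 & phi 1 - phi 0 = dphi c.
Proof.
move=> dp; have cp : {within `[0, 1], continuous phi}%classic.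
  apply: derivable_within_continuous => t _; have := dp t.
  by move=> /@ex_derive.
have [c cI E] := MVT ltr01 (fun t _ => dp t) cp.
by exists c; [rewrite in_itv /= in cI|rewrite E subr0 mulr1].
Qed.

Lemma mean_value F x v : (forall y, differentiable F y) ->
  exists2 c : R, 0 < c < 1 & F (x + v) - F x = 'D_v F (x + c *: v).
Proof.
move=> dF.
have [c c01 E] := @MVT_unit _ _ (fun t => is_derive_line (dF (x + t *: v))).
by exists c => //; rewrite -E scale1r scale0r addr0.
Qed.

Lemma differentiable_grad f i y : differentiable (grad f) y ->
  differentiable (fun z => grad f z i 0) y.
Proof.
move=> dg; apply: (@differentiable_comp _ _ _ _ (grad f) (fun z => z i 0)) => //.
exact: differentiable_coord.
Qed.

Lemma derive_grad_coord f x v i : differentiable (grad f) x ->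
  'D_v (fun y => grad f y i 0) x = (hess f x *m v) i 0.
Proof.
move=> dg; rewrite derive_coord ?mxE; last exact: differentiable_grad.
by apply: eq_bigr => j _; rewrite mxE mulrC.
Qed.

(** Symmetry of second derivatives. The second difference of f over the
    parallelogram spanned by h e_i and h e_j is h ^ 2 times a nearby value of
    either mixed derivative; let h tend to 0. *)
Lemma hess_sym f x : twice_continuously_differentiable f ->
  (hess f x)^T = hess f x.
Proof.
move=> [df dg ch].
pose e i : 'cV[R]_d := delta_mx i 0.
have close (u u' v w eps : R) : u = u' ->
    `|v - u| < eps / 2 -> `|w - u'| < eps / 2 -> `|v - w| < eps.
  move=> ->; rewrite !ltr_norml => /andP[? ?] /andP[? ?].
  by apply/andP; split; lra.
have diff2 i j h : h != 0 ->
    exists c1 c2 : R, [/\ 0 < c1 < 1, 0 < c2 < 1 &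
    f (x + h *: e i + h *: e j) - f (x + h *: e i) - f (x + h *: e j) + f x =
    h ^+ 2 * hess f (x + (c1 * h) *: e i + (c2 * h) *: e j) i j].
  move=> h0.
  have D1 y t : is_derive (t : R) (1 : R) (fun s : R => f (y + s *: (h *: e i)))
      (h * grad f (y + t *: (h *: e i)) i 0).
    have := is_derive_line (df (y + t *: (h *: e i))).
    by rewrite derive_grad // dotvZr dotvC dotv_delta.
  have [c1 c1P E1] := MVT_unit (fun t =>
    is_deriveB (D1 (x + h *: e j) t) (D1 x t)).
  have [c2 c2P E2] := @mean_value (fun z => grad f z i 0)
    (x + c1 *: (h *: e i)) (h *: e j) (fun z => differentiable_grad i (dg z)).
  exists c1, c2; split=> //; move: E1 E2.
  rewrite derive_grad_coord // -scalemxAr [X in _ -> _ = X -> _]mxE.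
  rewrite mulmx_delta !fctE !scale1r !scale0r !addr0 !scalerA => E1 E2.
  rewrite (addrAC x ((c1 * h) *: e i) (h *: e j)) in E2.
  by rewrite expr2 -mulrA -E2 mulrBr -E1 (addrAC x (h *: e i)); ring.
have near_eq i j (eps : R) : 0 < eps -> `|hess f x i j - hess f x j i| < eps.
  move=> eps0.
  have [dl dl0 dlP] : exists2 dl : R, 0 < dl &
    forall y, (forall k, `|x k 0 - y k 0| < dl) ->
    forall k l, `|hess f x k l - hess f y k l| < eps / 2.
    have /nbhs_ballP[dl dl0 dlP] :
        nbhs x (fun y => ball (hess f x) (eps / 2) (hess f y)).
      by apply: ch; apply: nbhsx_ballx; rewrite divr_gt0.
    exists dl => // y yd; have [|_] := dlP y; last by [].
    by split=> // k l; rewrite ord1; apply: yd.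
  have [h h0 h4] : exists2 h : R, 0 < h & h * 4 = dl.
    by exists (dl / 4); [rewrite divr_gt0|rewrite divfK // pnatr_eq0].
  have near (c1 c2 : R) k l : 0 < c1 < 1 -> 0 < c2 < 1 -> forall m,
    `|x m 0 - (x + (c1 * h) *: e k + (c2 * h) *: e l) m 0| < dl.
    move=> /andP[a1 a2] /andP[b1 b2] m; rewrite !mxE eqxx !andbT.
    have cb (c : R) (bb : bool) : 0 < c -> c < 1 -> `|c * h * bb%:R| <= h.
      move=> c0 c1'; case: bb; rewrite ?mulr0 ?normr0 ?(ltW h0) // mulr1.
      by rewrite ger0_norm ?mulr_ge0 ?(ltW h0) ?(ltW c0) // ler_piMl ?ltW.
    rewrite -!addrA opprD addrA subrr add0r normrN.
    apply: le_lt_trans (ler_normD _ _) _.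
    apply: le_lt_trans (lerD (cb _ _ a1 a2) (cb _ _ b1 b2)) _.
    have -> : h + h = h * 2 by ring.
    by rewrite -h4 ltr_pM2l // ltr_nat.
  have [c1 [c2 [p1 p2 E]]] := diff2 i j h (lt0r_neq0 h0).
  have [c3 [c4 [p3 p4 E']]] := diff2 j i h (lt0r_neq0 h0).
  have /(mulfI (lt0r_neq0 (exprn_gt0 2 h0))) EE :
    h ^+ 2 * hess f (x + (c1 * h) *: e i + (c2 * h) *: e j) i j =
    h ^+ 2 * hess f (x + (c3 * h) *: e j + (c4 * h) *: e i) j i.
    by rewrite -E -E' [in RHS](addrAC x) [in RHS](addrAC (f _)).
  exact: close EE (dlP _ (near _ _ i j p1 p2) i j)
    (dlP _ (near _ _ j i p3 p4) j i).
apply/matrixP => i j; rewrite [LHS]mxE; apply/eqP/contraT => ne.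
by rewrite -subr_eq0 -normr_gt0 in ne; have := near_eq j i _ ne; rewrite ltxx.
Qed.

(** The mean value theorem gives the constant L instead of the sharp L / 2; the
    segment stays in the orthant, where the Lipschitz bound is available. *)
Lemma descent_lemma f (L : R) x y : (forall z, differentiable f z) ->
  (forall x y, orthant x -> orthant y ->
     norm2 (grad f x - grad f y) <= L * norm2 (x - y)) -> 0 <= L ->
  orthant x -> orthant y ->
  f y - f x <= dotv (grad f x) (y - x) + L * dotv (y - x) (y - x).
Proof.
move=> df lip L0 ox oy; have [c /andP[c0 c1]] := mean_value x (y - x) df.
rewrite derive_grad // subrKC => ->.
set z := x + _; rewrite -[grad f z](subrKC (grad f x)).
rewrite (dotvDl (y - x) (grad f x)) lerD2l.
apply: le_trans (dotv_le_norm2 _ _) _.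
have oz : orthant z.
  move=> i; rewrite !mxE.
  have -> : x i 0 + c * (y i 0 - x i 0) = (1 - c) * x i 0 + c * y i 0 by ring.
  by rewrite addr_ge0 // mulr_ge0 // ?subr_ge0 ?(ltW c1) ?(ltW c0).
apply: le_trans (ler_wpM2r (norm2_ge0 _) (lip _ _ oz ox)) _.
rewrite -sqr_norm2 expr2 mulrA ler_wpM2r ?norm2_ge0 // ler_wpM2l //.
rewrite /z addrC addKr /norm2 ler_wsqrtr // dotvZl dotvZr mulrA.
by rewrite ler_piMl ?dotv_ge0 // mulr_ile1 // ltW.
Qed.

End Calculus.

(** * Curvature and second order growth *)

Section LocalGeometry.
Variables (R : realType) (d : nat).
Implicit Types (f : 'cV[R]_d -> R) (x y v w z : 'cV[R]_d) (A : {set 'I_d}).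

Lemma positive_lower_bound (A : {set 'I_d}) (F : 'I_d -> R) :
  (forall i, i \in A -> 0 < F i) ->
  exists2 c, 0 < c & forall i, i \in A -> c <= F i.
Proof.
move=> F0; exists (\big[Num.min/1]_(i in A) F i).
  by apply/bigmin_gtP; split.
by move=> i iA; apply: bigmin_le_cond.
Qed.

Lemma nbhs_dotv x (P : set 'cV[R]_d) : nbhs x P ->
  exists2 r : R, 0 < r & forall y, dotv (y - x) (y - x) < r ^+ 2 -> P y.
Proof.
move=> /nbhs_ballP[r r0 rP]; exists r => // y yr; apply: rP; split=> // i j.
rewrite ord1 /ball /= distrC -(@ltr_pXn2r _ 2) ?nnegrE ?normr_ge0 ?(ltW r0) //.
apply: le_lt_trans yr; rewrite real_normK ?num_real //.
by have := sqr_le_dotv (y - x) i; rewrite !mxE.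
Qed.

Lemma form_ge_entries (M : 'M[R]_d) eps z : (forall i j, `|M i j| <= eps) ->
  - (eps * d%:R * dotv z z) <= dotv z (M *m z).
Proof.
move=> Meps.
have entry i j : - (eps * (2^-1 * (z i 0 ^+ 2 + z j 0 ^+ 2)))
    <= z i 0 * (M i j * z j 0).
  rewrite lerNl; apply: le_trans (ler_norm _) _.
  rewrite normrN mulrCA !normrM.
  apply: le_trans (ler_wpM2r _ (Meps i j)) _; first by rewrite mulr_ge0.
  apply: ler_wpM2l; first exact: le_trans (Meps i j).
  have := sqr_ge0 (`|z i 0| - `|z j 0|).
  rewrite -[z i 0 ^+ 2]real_normK ?num_real // -[z j 0 ^+ 2]real_normK ?num_real //.
  move: `|z i 0| `|z j 0| => a b; nra.
apply: (@le_trans _ _ (\sum_i \sum_j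
    - (eps * (2^-1 * (z i 0 ^+ 2 + z j 0 ^+ 2))))); last first.
  apply: ler_sum => i _; rewrite mxE mulr_sumr.
  exact: ler_sum.
under eq_bigr do
  rewrite sumrN -mulr_sumr -mulr_sumr big_split /= sumr_const card_ord.
rewrite sumrN -mulr_sumr -mulr_sumr big_split /= sumr_const card_ord.
have -> : \sum_(i < d) z i 0 ^+ 2 = dotv z z.
  by apply: eq_bigr => i _; rewrite expr2.
under eq_bigr do rewrite -mulr_natr.
rewrite -mulr_suml.
have -> : \sum_(i < d) z i 0 ^+ 2 = dotv z z.
  by apply: eq_bigr => i _; rewrite expr2.
rewrite -mulr_natr le_eqVlt; apply/orP; left; apply/eqP.
by field.
Qed.

(** The form is uniformly positive at x; a perturbation of each Hessian entry by at
    most mu / (2 (d + 1)) costs at most half of the constant. *)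
Lemma hess_positive_near f x A : twice_continuously_differentiable f ->
  (forall z, z <> 0 -> (forall i, i \in A -> z i 0 = 0) ->
     0 < dotv z (hess f x *m z)) ->
  exists2 mu, 0 < mu & exists2 r : R, 0 < r & forall y z,
    dotv (y - x) (y - x) < r ^+ 2 -> (forall i, i \in A -> z i 0 = 0) ->
    mu * dotv z z <= dotv z (hess f y *m z).
Proof.
move=> f2 pos.
have [z z0 zA|mu mu0 muP] := @uniform_positivity _ _ _ (~: A) (hess_sym x f2).
  by apply: pos => // i iA; apply: zA; rewrite inE negbK.
have arith (a b q u : R) : - u <= a - b -> mu * q <= b -> u <= mu / 2 * q ->
    mu / 2 * q <= a by lra.
pose eps := mu / (2 * (d.+1)%:R).
have eps0 : 0 < eps by rewrite divr_gt0 // mulr_gt0 // ltr0n.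
have [_ _ ch] := f2.
have [r r0 rP] : exists2 r : R, 0 < r & forall y,
    dotv (y - x) (y - x) < r ^+ 2 -> ball (hess f x) eps (hess f y).
  by apply: nbhs_dotv; apply: ch; apply: nbhsx_ballx.
exists (mu / 2); first by rewrite divr_gt0.
exists r => // y z /rP[_ yP] zA.
have := @form_ge_entries (hess f y - hess f x) eps z _.
rewrite mulmxBl dotvBr => H.
have {}H : - (eps * d%:R * dotv z z)
    <= dotv z (hess f y *m z) - dotv z (hess f x *m z).
  apply: H => i j; rewrite [X in `|X|]mxE [X in `|_ + X|]mxE distrC ltW //.
  exact: yP.
have Hz : mu * dotv z z <= dotv z (hess f x *m z).
  by apply: muP => i; rewrite inE negbK; apply: zA.
have e : eps * d%:R <= mu / 2.
  rewrite /eps mulrAC ler_pdivrMr ?mulr_gt0 ?ltr0n //.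
  rewrite (_ : mu / 2 * (2 * (d.+1)%:R) = mu * (d.+1)%:R); last by field.
  by rewrite ler_pM2l // ler_nat.
exact: arith H Hz (ler_wpM2r (dotv_ge0 z) e).
Qed.

Lemma grad_mean_value f x v w : twice_continuously_differentiable f ->
  exists2 c : R, 0 < c < 1 &
    dotv (grad f (x + w)) v - dotv (grad f x) v =
    dotv v (hess f (x + c *: w) *m w).
Proof.
move=> [_ dg _].
have D (t : R) : is_derive t (1 : R)
   (\sum_(i < d) (v i 0 \*: (fun s : R => grad f (x + s *: w) i 0)))
   (\sum_(i < d) v i 0 * (hess f (x + t *: w) *m w) i 0).
  apply: is_derive_sum => i; apply: is_deriveZ.
  have := is_derive_line (differentiable_grad i (dg (x + t *: w))).
  by rewrite derive_grad_coord.
have [c c01 E] := MVT_unit D; exists c => //.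
rewrite [RHS]/dotv -E !fct_sumE; congr (_ - _); apply: eq_bigr => i _.
  by rewrite mulrC /= scale1r.
by rewrite mulrC /= scale0r addr0.
Qed.

(** Mean value theorem for t |-> f (x + t v) - (mu / 2) |v| ^ 2 t ^ 2, whose
    derivative is nonnegative on the unit interval. *)
Lemma second_order_growth f x v mu : twice_continuously_differentiable f ->
  0 <= dotv (grad f x) v ->
  (forall c : R, 0 < c < 1 ->
     mu * dotv v v <= dotv v (hess f (x + c *: v) *m v)) ->
  mu / 2 * dotv v v <= f (x + v) - f x.
Proof.
move=> f2 g0 pos; have [df dg _] := f2.
have D (t : R) : is_derive t (1 : R)
   ((fun s : R => f (x + s *: v)) - (mu / 2 * dotv v v) \*: (fun s => s ^+ 2))
   (dotv (grad f (x + t *: v)) v - (mu / 2 * dotv v v) * (t *+ 2)).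
  apply: is_deriveB.
    by have := is_derive_line (df (x + t *: v)); rewrite derive_grad.
  apply: is_deriveZ; apply: is_derive_eq.
  by rewrite [_ *: _]mulr1 mulr2n.
have [c /andP[c0 c1]] := MVT_unit D; rewrite !fctE /=.
rewrite scale1r scale0r addr0 expr1n expr0n /= => E.
have [c' /andP[c'0 c'1]] := grad_mean_value x v (c *: v) f2.
rewrite scalerA -scalemxAr dotvZr => E'.
have c'c : 0 < c' * c < 1 by rewrite mulr_gt0 //= mulr_ilt1 ?ltW.
have := pos _ c'c; rewrite -(ler_pM2l c0) -E'.
have arith (fy fx a b q : R) :
    fy - mu / 2 * q * 1 - (fx - mu / 2 * q * 0) = a - mu / 2 * q * (c *+ 2) ->
    0 <= b -> c * (mu * q) <= a - b -> mu / 2 * q <= fy - fx.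
  by rewrite -mulr_natl; lra.
exact: arith E g0.
Qed.

End LocalGeometry.

(** * The search direction and the line search *)

Section Direction.
Variables (R : realType) (d : nat).
Implicit Types (f : 'cV[R]_d -> R) (x y p v z : 'cV[R]_d) (A S : {set 'I_d}).

(** Restriction to S as a matrix, so that principal submatrices become products
    and extension by zero becomes the transpose. *)
Definition select S : 'M[R]_(#|S|, d) := \matrix_(i, j) (enum_val i == j)%:R.

Lemma principal_submxE S (H : 'M[R]_d) :
  principal_submx S H = select S *m H *m (select S)^T.
Proof.
apply/matrixP => i j; rewrite !mxE (bigD1 (enum_val j)) //=.
rewrite [X in _ = _ + X]big1 ?addr0 => [|k kj]; last first.
  by rewrite !mxE eq_sym (negbTE kj) mulr0.
rewrite !mxE eqxx mulr1 (bigD1 (enum_val i)) //= !mxE eqxx mul1r.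
by rewrite big1 ?addr0 // => k ki; rewrite mxE eq_sym (negbTE ki) mul0r.
Qed.

Lemma select_tr_outside S (z : 'cV[R]_#|S|) i : i \notin S ->
  ((select S)^T *m z) i 0 = 0.
Proof.
move=> iS; rewrite mxE big1 // => k _; rewrite !mxE.
by case: eqP => [e|_]; [rewrite -e enum_valP in iS|rewrite mul0r].
Qed.

Lemma dotv_select_tr S (z : 'cV[R]_#|S|) :
  dotv ((select S)^T *m z) ((select S)^T *m z) = dotv z z.
Proof.
rewrite !dotvE trmx_mul trmxK -mulmxA (mulmxA (select S)).
suff -> : select S *m (select S)^T = 1%:M by rewrite mul1mx.
apply/matrixP => i j; rewrite !mxE (bigD1 (enum_val i)) //= !mxE eqxx mul1r.
rewrite big1 ?addr0 => [|k ki].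
  by rewrite (inj_eq enum_val_inj) eq_sym.
by rewrite mxE eq_sym (negbTE ki) mul0r.
Qed.

Lemma dotv_subvec S u v :
  dotv (subvec S u) (subvec S v) = \sum_(i in S) u i 0 * v i 0 :> R.
Proof.
by rewrite [RHS]big_enum_val; apply: eq_bigr => i _; rewrite !mxE.
Qed.

Lemma active_orthant x delta i : orthant x ->
  (i \in active x delta) = (x i 0 <= delta).
Proof. by move=> ox; rewrite !inE ox. Qed.

Lemma inactive_orthant x delta : orthant x ->
  inactive x delta = ~: active x delta.
Proof. by move=> ox; apply/setP => i; rewrite !inE ox ltNge. Qed.

(** The principal submatrix inherits the positivity of the Hessian, through
    extension by zero, so the descent bound of the minimal residual iterates
    applies to the inactive block. *)
Lemma local_direction_descent f eta delta x p A (mu : R) : 0 < mu ->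
  active x delta = A -> inactive x delta = ~: A ->
  (hess f x)^T = hess f x ->
  (forall z, (forall i, i \in A -> z i 0 = 0) ->
     mu * dotv z z <= dotv z (hess f x *m z)) ->
  local_direction f eta delta x p ->
  [/\ forall i, i \in A -> p i 0 = - grad f x i 0,
      mu / 2 * \sum_(i in ~: A) p i 0 ^+ 2 <=
        - \sum_(i in ~: A) grad f x i 0 * p i 0 &
      (mu / 2) ^+ 2 * \sum_(i in ~: A) p i 0 ^+ 2 <=
        \sum_(i in ~: A) grad f x i 0 ^+ 2].
Proof.
move=> mu0 eA eI symH posH; rewrite /local_direction eA eI => -[pA [ty pI]].
have sq (u : 'cV[R]_d) : \sum_(i in ~: A) u i 0 ^+ 2
    = dotv (subvec (~: A) u) (subvec (~: A) u).
  by rewrite dotv_subvec; apply: eq_bigr => i _; rewrite expr2.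
have desc : mu / 2 * dotv (subvec (~: A) p) (subvec (~: A) p) <=
    - dotv (subvec (~: A) (grad f x)) (subvec (~: A) p).
  apply: minres_descent pI => //.
    by rewrite principal_submxE !trmx_mul trmxK symH mulmxA.
  move=> z; rewrite principal_submxE -(dotv_select_tr z).
  have -> : dotv z (select (~: A) *m hess f x *m (select (~: A))^T *m z) =
      dotv ((select (~: A))^T *m z) (hess f x *m ((select (~: A))^T *m z)).
    by rewrite !dotvE trmx_mul trmxK !mulmxA.
  by apply: posH => i iA; rewrite select_tr_outside // inE negbK.
split.
- move=> i iA; have /colP/(_ (enum_rank_in iA i)) := pA.
  by rewrite !mxE enum_rankK_in // => ->.
- by rewrite sq -dotv_subvec.
rewrite !sq; apply: descent_direction_bound desc.
by rewrite divr_gt0.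
Qed.

(** Coordinatewise: the quadratic error L D ^ 2 is absorbed by the linear
    decrease, on A because the projected displacement D satisfies
    0 <= - D <= alpha g, off A because p is a direction of quadratic descent. *)
Lemma line_search_cond_small f L rho delta x p A mu alpha :
  (forall z, differentiable f z) ->
  (forall x y, orthant x -> orthant y ->
     norm2 (grad f x - grad f y) <= L * norm2 (x - y)) -> 0 <= L ->
  orthant x -> active x delta = A -> inactive x delta = ~: A ->
  (forall i, i \in A -> p i 0 = - grad f x i 0) ->
  (forall i, i \in A -> 0 <= grad f x i 0) ->
  (forall i, i \notin A -> 0 <= x i 0 + alpha * p i 0) ->
  mu / 2 * \sum_(i in ~: A) p i 0 ^+ 2 <=
    - \sum_(i in ~: A) grad f x i 0 * p i 0 ->
  0 <= alpha -> rho < 1 ->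
  L * alpha <= 1 - rho -> L * alpha <= (1 - rho) * (mu / 2) ->
  line_search_cond f rho delta x p alpha.
Proof.
move=> df lip L0 ox eA eI pA gA xI desc a0 rho1 La1 La2.
rewrite /line_search_cond eA eI.
have -> : proj_orthant (subvec A x + alpha *: subvec A p) - subvec A x =
    subvec A (proj_orthant (x + alpha *: p) - x) by apply/colP => i; rewrite !mxE.
rewrite !dotv_subvec; set y := proj_orthant _.
have oy : orthant y by move=> i; rewrite mxE le_max lexx orbT.
apply: le_trans (descent_lemma df lip L0 ox oy) _.
rewrite /dotv !(bigID (mem A) predT) /=.
have yI i : i \notin A -> (y - x) i 0 = alpha * p i 0.
  move=> iA; rewrite !mxE max_l ?xI //.
  by rewrite addrAC subrr add0r.
have onA : \sum_(i in A) grad f x i 0 * (y - x) i 0 +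
    L * \sum_(i in A) (y - x) i 0 * (y - x) i 0 <=
    rho * \sum_(i in A) grad f x i 0 * (y - x) i 0.
  rewrite !mulr_sumr -big_split /=; apply: ler_sum => i iA.
  have -> : (y - x) i 0 = Num.max (x i 0 + alpha * p i 0) 0 - x i 0.
    by rewrite !mxE.
  have := gA i iA; have := ox i; rewrite pA //.
  move: (x i 0) (grad f x i 0) => X G X0 G0.
  have [D0 D1] : Num.max (X + alpha * - G) 0 - X <= 0 /\
     - (alpha * G) <= Num.max (X + alpha * - G) 0 - X.
    have aG : 0 <= alpha * G by rewrite mulr_ge0.
    rewrite mulrN; split; first by rewrite subr_le0 ge_max X0 andbT gerBl.
    by rewrite lerBrDl le_max lexx.
  move: (Num.max _ _ - X) D0 D1 => D D0 D1.
  rewrite -subr_le0.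
  have -> : G * D + L * (D * D) - rho * (G * D) = D * ((1 - rho) * G + L * D).
    by ring.
  rewrite mulr_le0_ge0 //.
  have := ler_wpM2l L0 D1; have := ler_wpM2r G0 La1; lra.
have nI (i : 'I_d) : (i \in ~: A) = (i \notin A) by rewrite inE.
have s1 : \sum_(i | i \notin A) grad f x i 0 * (y - x) i 0 =
    alpha * \sum_(i in ~: A) grad f x i 0 * p i 0.
  rewrite mulr_sumr (eq_bigl _ _ nI); apply: eq_bigr => i iA.
  by rewrite yI // mulrCA.
have s2 : \sum_(i | i \notin A) (y - x) i 0 * (y - x) i 0 =
    alpha * (alpha * \sum_(i in ~: A) p i 0 ^+ 2).
  rewrite !mulr_sumr (eq_bigl _ _ nI); apply: eq_bigr => i iA.
  by rewrite yI // expr2; ring.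
rewrite s1 s2.
have P0 : 0 <= \sum_(i in ~: A) p i 0 ^+ 2.
  by apply: sumr_ge0 => i _; apply: sqr_ge0.
move: onA P0 desc.
move: (\sum_(i in A) _) (\sum_(i in A) _) => SA SA'.
move: (\sum_(i in ~: A) p i 0 ^+ 2) (\sum_(i in ~: A) grad f x i 0 * p i 0).
move=> P G onA P0 desc.
have rho0 : 0 <= 1 - rho by rewrite subr_ge0 ltW.
have offA : alpha * G + L * (alpha * (alpha * P)) <= alpha * rho * G.
  rewrite -subr_le0.
  have -> : alpha * G + L * (alpha * (alpha * P)) - alpha * rho * G =
     alpha * (L * alpha * P - (1 - rho) * (- G)) by ring.
  rewrite mulr_ge0_le0 // subr_le0.
  apply: le_trans (ler_wpM2r P0 La2) _; rewrite -mulrA.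
  exact: ler_wpM2l.
by move: onA offA; lra.
Qed.

End Direction.

(** * The geometry of a nondegenerate local minimum *)

Lemma quadratic_nonneg_slope (R : realType) (g L e : R) : 0 < e -> 0 <= L ->
  (forall t, `|t| < e -> 0 <= t * g + L * t ^+ 2) -> g = 0.
Proof.
move=> e0 L0 H; apply/eqP/contraT => g0.
have gg : 0 < `|g| by rewrite normr_gt0.
pose D := `|g| + L * e + 1.
have Le : 0 <= L * e by rewrite mulr_ge0 // ltW.
have D0 : 0 < D by rewrite ltr_wpDl // addr_ge0.
pose t := e / D; have t0 : 0 < t by rewrite divr_gt0.
have := H (- (t * g)); rewrite normrN normrM gtr0_norm //.
have -> : t * `|g| < e.
  rewrite /t mulrAC ltr_pdivrMr // ltr_pM2l // /D; lra.
have Lt : L * t < 1.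
  rewrite /t mulrA ltr_pdivrMr // mul1r /D; lra.
move=> /(_ isT).
have -> : - (t * g) * g + L * (- (t * g)) ^+ 2 = - (t * g ^+ 2 * (1 - L * t)).
  by ring.
rewrite oppr_ge0 leNgt mulr_gt0 ?subr_gt0 // mulr_gt0 //.
by rewrite -real_normK ?num_real // exprn_gt0.
Qed.

Lemma sqrD_le (R : realType) (a b : R) :
  (a + b) * (a + b) <= 2 * (a * a) + 2 * b ^+ 2.
Proof.
rewrite -subr_ge0.
suff -> : 2 * (a * a) + 2 * b ^+ 2 - (a + b) * (a + b) = (a - b) ^+ 2.
  exact: sqr_ge0.
by ring.
Qed.

Section LocalMinimum.
Variables (R : realType) (d : nat) (f : 'cV[R]_d -> R).
Hypothesis f_C2 : twice_continuously_differentiable f.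
Variable Lg : R.
Hypothesis Lg_ge0 : 0 <= Lg.
Hypothesis grad_lipschitz : forall x y : 'cV[R]_d, orthant x -> orthant y ->
  norm2 (grad f x - grad f y) <= Lg * norm2 (x - y).
Variable xs : 'cV[R]_d.
Hypothesis xs_min : constrained_local_min f xs.
Implicit Types (x y z v p : 'cV[R]_d).

Local Notation A := (active xs 0).

Let f_diff x : differentiable f x. Proof. by case: f_C2. Qed.
Let xs_ge0 : orthant xs. Proof. by case: xs_min. Qed.

Lemma active_xs i : (i \in A) = (xs i 0 == 0).
Proof. by rewrite active_orthant // eq_le xs_ge0 andbT. Qed.

Lemma notin_active_xs i : (i \notin A) = (0 < xs i 0).
Proof. by rewrite active_orthant // ltNge. Qed.

(** Inactive coordinates of xs exceed 2 delta, so a perturbation by less than delta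
    cannot move a coordinate across the threshold delta. *)
Lemma active_near delta x :
  (forall i, i \in inactive xs 0 -> delta < 2^-1 * xs i 0) -> 0 < delta ->
  orthant x -> dotv (x - xs) (x - xs) < delta ^+ 2 ->
  active x delta = A /\ inactive x delta = ~: A.
Proof.
move=> delta_lt delta0 ox xn.
have near i : `|x i 0 - xs i 0| < delta.
  rewrite -(@ltr_pXn2r _ 2) ?nnegrE ?(ltW delta0) // real_normK ?num_real //.
  by apply: le_lt_trans xn; have := sqr_le_dotv (x - xs) i; rewrite !mxE.
have eA : active x delta = A.
  apply/setP => i; rewrite active_orthant //; have := near i.
  have [iA|iA] := boolP (i \in A).
    move: iA; rewrite active_xs => /eqP->; rewrite subr0 => H.
    by rewrite (ltW (le_lt_trans (ler_norm _) H)).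
  have /delta_lt : i \in inactive xs 0 by rewrite inE -notin_active_xs.
  rewrite ltr_distlC => H /andP[H1 H2]; apply/negbTE; rewrite -ltNge.
  move: H H2; move: (x i 0) (xs i 0) => a b; lra.
by rewrite inactive_orthant // eA.
Qed.

(** Moving an inactive coordinate by a small t of either sign is feasible, so
    t g_i + L t ^ 2 is nonnegative for all small t. *)
Lemma stationary_off_active i : i \notin A -> grad f xs i 0 = 0.
Proof.
rewrite notin_active_xs => xi0; have [_ [e e0 emin]] := xs_min.
apply: (@quadratic_nonneg_slope _ _ Lg (Num.min e (xs i 0))) => //.
  by rewrite lt_min e0.
move=> t; rewrite lt_min => /andP[te txi].
pose y := xs + t *: delta_mx i 0.
have yx : y - xs = t *: delta_mx i 0 by rewrite /y addrC addKr.
have qy : dotv (y - xs) (y - xs) = t ^+ 2.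
  by rewrite yx dotvZl dotvZr dotv_delta mxE !eqxx mulr1 expr2.
have oy : orthant y.
  move=> j; rewrite !mxE eqxx andbT; have [->|ji] := eqVneq j i.
    by rewrite mulr1; move: txi; rewrite ltr_norml => /andP[+ _]; lra.
  by rewrite mulr0 addr0; apply: xs_ge0.
have yball : ball2 xs e y.
  rewrite /ball2 /= norm2_lt // qy -real_normK ?num_real //.
  by rewrite ltr_pXn2r ?nnegrE ?(ltW e0).
have := emin y oy yball; rewrite -subr_ge0 => /le_trans; apply.
apply: le_trans (descent_lemma f_diff grad_lipschitz Lg_ge0 xs_ge0 oy) _.
by rewrite qy yx dotvZr dotvC dotv_delta lexx.
Qed.

Lemma grad_off_active x : orthant x ->
  \sum_(i in ~: A) grad f x i 0 ^+ 2 <= Lg ^+ 2 * dotv (x - xs) (x - xs).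
Proof.
move=> ox; rewrite -sqr_norm2 -exprMn.
apply: (@le_trans _ _ (norm2 (grad f x - grad f xs) ^+ 2)); last first.
  by rewrite ler_pXn2r ?nnegrE ?mulr_ge0 ?norm2_ge0 // grad_lipschitz.
rewrite sqr_norm2 /dotv [leRHS](bigID (mem (~: A))) /=.
rewrite -[leLHS]addr0 lerD //.
  apply: ler_sum => i; rewrite inE => /stationary_off_active g0.
  have -> : (grad f x - grad f xs) i 0 = grad f x i 0 - grad f xs i 0.
    by rewrite [LHS]mxE [X in _ + X]mxE.
  by rewrite g0 subr0 expr2.
by apply: sumr_ge0 => i _; rewrite -expr2 sqr_ge0.
Qed.

Hypothesis xs_nondegenerate : forall i, i \in A -> 0 < grad f xs i 0.

Lemma grad_active_near : exists2 c, 0 < c & exists2 r : R, 0 < r &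
  forall x i, orthant x -> dotv (x - xs) (x - xs) < r ^+ 2 -> i \in A ->
  c <= grad f x i 0.
Proof.
have [c c0 cP] := positive_lower_bound xs_nondegenerate.
exists (c / 2); first by rewrite divr_gt0.
have L1 : 0 < Lg + 1 by rewrite ltr_wpDl.
exists (c / (2 * (Lg + 1))); first by rewrite divr_gt0 // mulr_gt0.
move=> x i ox xn iA.
have dg : `|grad f x i 0 - grad f xs i 0| <= Lg * norm2 (x - xs).
  apply: le_trans (grad_lipschitz ox xs_ge0).
  rewrite -(@ler_pXn2r _ 2) ?nnegrE ?norm2_ge0 //.
  rewrite real_normK ?num_real // sqr_norm2.
  have := sqr_le_dotv (grad f x - grad f xs) i.
  by rewrite [X in X ^+ 2]mxE [X in _ + X]mxE.
move: xn; rewrite -norm2_lt ?divr_gt0 ?mulr_gt0 // => xn.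
have n0 := norm2_ge0 (x - xs).
have Ln : Lg * norm2 (x - xs) <= c / 2.
  apply: (@le_trans _ _ ((Lg + 1) * (c / (2 * (Lg + 1))))); last first.
    by rewrite le_eqVlt; apply/orP; left; apply/eqP; field; rewrite gt_eqF.
  by apply: ler_pM => //; [rewrite lerDl|apply: ltW].
have := cP i iA; have := le_trans dg Ln; rewrite ler_norml => /andP[+ _].
by move: (grad f x i 0) (grad f xs i 0) => a b; lra.
Qed.

Hypothesis xs_sosc : forall z : 'cV[R]_d, z <> 0 ->
  (forall i, i \in A -> z i 0 = 0) -> 0 < dotv z (hess f xs *m z).

(** Split the displacement into its inactive part v and its active part. Along
    v the first derivative vanishes and the curvature is positive; along the
    active part f already grows linearly, by strict complementarity. *)
Lemma quadratic_growth : exists2 m, 0 < m & exists2 r : R, 0 < r &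
  forall x, orthant x -> dotv (x - xs) (x - xs) < r ^+ 2 ->
  m * dotv (x - xs) (x - xs) <= f x - f xs.
Proof.
have [mu mu0 [r1 r10 posH]] := hess_positive_near f_C2 xs_sosc.
have [c c0 [r2 r20 gA]] := grad_active_near.
pose r := Num.min 1 (Num.min r1 r2).
have r0 : 0 < r by rewrite !lt_min ltr01 r10.
have rsq s : r <= s -> r ^+ 2 <= s ^+ 2.
  by move=> rs; rewrite ler_pXn2r // nnegrE ltW // (lt_le_trans r0).
exists (Num.min c (mu / 2)); first by rewrite lt_min c0 divr_gt0.
exists r => // x ox xn.
pose v : 'cV[R]_d := \col_i (if i \in A then 0 else x i 0 - xs i 0).
pose w := x - xs - v.
have vA i : i \in A -> v i 0 = 0 by move=> iA; rewrite mxE iA.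
have wI i : i \notin A -> w i 0 = 0.
  by move=> iA; rewrite !mxE (negbTE iA) subrr.
have wA i : i \in A -> w i 0 = x i 0.
  move=> iA; rewrite !mxE iA; move: iA; rewrite active_xs => /eqP->.
  by rewrite !subr0.
have q_split (t : R) :
    dotv (v + t *: w) (v + t *: w) = dotv v v + t ^+ 2 * dotv w w.
  have vw : dotv v w = 0.
    rewrite /dotv big1 // => i _; have [iA|iA] := boolP (i \in A).
      by rewrite vA // mul0r.
    by rewrite wI // mulr0.
  rewrite !(dotvDl _ v) !(dotvDr _ v) !dotvZl !dotvZr (dotvC w v) vw; ring.
have xE : x - xs = v + w by rewrite /w subrKC.
have q1 : dotv (x - xs) (x - xs) = dotv v v + dotv w w.
  by have := q_split 1; rewrite scale1r expr1n mul1r -xE.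
have wq := dotv_ge0 w; have vq := dotv_ge0 v.
have qs (t : R) : 0 <= t <= 1 ->
    dotv (v + t *: w) (v + t *: w) <= dotv (x - xs) (x - xs).
  move=> /andP[t0 t1]; rewrite q_split q1 lerD2l ler_piMl //.
  by rewrite expr_le1.
have f1 : mu / 2 * dotv v v <= f (xs + v) - f xs.
  apply: second_order_growth => // [|s /andP[s0 s1]].
    rewrite /dotv big1 // => i _; have [iA|iA] := boolP (i \in A).
      by rewrite vA // mulr0.
    by rewrite stationary_off_active // mul0r.
  apply: posH => //; rewrite addrC addKr dotvZl dotvZr mulrA.
  apply: le_lt_trans (lt_le_trans xn (rsq r1 _)); last first.
    by rewrite !ge_min lexx orbT.
  rewrite q1; apply: (@le_trans _ _ (dotv v v)); last by rewrite lerDl.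
  by rewrite ler_piMl // mulr_ile1 // ltW.
have f2 : c * dotv w w <= f x - f (xs + v).
  have [s /andP[s0 s1]] := mean_value (xs + v) w f_diff.
  rewrite derive_grad // -addrA -xE subrKC => ->.
  rewrite /dotv mulr_sumr; apply: ler_sum => i _.
  have [iA|iA] := boolP (i \in A); last by rewrite !wI // !mulr0.
  have gi : c <= grad f (xs + v + s *: w) i 0.
    apply: gA => //.
      move=> j; rewrite mxE [X in X + _]mxE [X in _ + X]mxE.
      have [jA|jA] := boolP (j \in A).
        rewrite vA // wA // addr0; move: jA; rewrite active_xs => /eqP->.
        by rewrite add0r mulr_ge0 // ltW.
      by rewrite wI // mulr0 addr0 mxE (negbTE jA) subrKC.
    have -> : xs + v + s *: w - xs = v + s *: w.
      by rewrite -(addrA xs) [LHS]addrC addKr.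
    apply: le_lt_trans (qs s _) _; first by rewrite !ltW.
    by apply: lt_le_trans xn (rsq r2 _); rewrite !ge_min lexx !orbT.
  rewrite wA //; have xi0 := ox i.
  have xi1 : x i 0 <= 1.
    rewrite -(@expr_le1 _ 2) //; apply: (@le_trans _ _ (r ^+ 2)).
      apply: le_trans (ltW xn).
      have := sqr_le_dotv (x - xs) i; rewrite mxE [X in _ + X]mxE.
      by move: iA; rewrite active_xs => /eqP->; rewrite subr0.
    by rewrite expr_le1 ?(ltW r0) // ge_min lexx.
  rewrite mulrA; apply: ler_wpM2r => //; apply: le_trans gi.
  by rewrite ler_piMr // ltW.
have mvw a q : 0 <= q -> Num.min c (mu / 2) <= a ->
    Num.min c (mu / 2) * q <= a * q.
  by move=> q0 ma; apply: ler_wpM2r.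
rewrite q1 mulrDr; have := mvw (mu / 2) _ vq; have := mvw c _ wq.
rewrite !ge_min !lexx orbT => /(_ isT) H1 /(_ isT) H2.
apply: le_trans (lerD (le_trans H2 f1) (le_trans H1 f2)) _.
by rewrite addrC addrA subrK.
Qed.

(** * One step near the minimum *)

Section Step.
Variables delta rho zeta : R.
Hypothesis delta_gt0 : 0 < delta.
Hypothesis delta_lt : forall i, i \in inactive xs 0 -> delta < 2^-1 * xs i 0.
Hypothesis rho_bounds : 0 < rho < 2^-1.
Hypothesis zeta_bounds : 0 < zeta < 1.

(** Backtracking stops at 1 or right after a failing trial step, and the latter
    exceeds amax. *)
Lemma step_size_lower_bound x p j amax : 0 < amax <= 1 ->
  (forall alpha, 0 <= alpha <= amax ->
     line_search_cond f rho delta x p alpha) ->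
  (forall l, (l < j)%N -> ~~ line_search_cond f rho delta x p (zeta ^+ l)) ->
  zeta * amax <= zeta ^+ j <= 1.
Proof.
have /andP[z0 z1] := zeta_bounds.
move=> /andP[a0 a1] small fails; apply/andP; split; last first.
  by rewrite exprn_ile1 // ltW.
case: j fails => [|j] fails; first by rewrite expr0 mulr_ile1 // ltW.
rewrite exprS ler_pM2l // leNgt; apply/negP => lt.
have /negP := fails j (ltnSn j); apply; apply: small.
by rewrite exprn_ge0 ltW.
Qed.

(** The radius r is chosen after the growth constant m, the curvature mu, the
    gradient gap c and the step size floor: a step from the set below cannot
    leave the ball where growth holds, hence, as f does not increase, not even the
    set itself, while every active coordinate is below r, hence below the
    displacement alpha * c, and so gets projected to 0. *)
Lemma identifying_neighbourhood : exists2 m, 0 < m & exists2 r : R, 0 < r &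
  forall eta x x', local_step f rho zeta eta delta x x' ->
  [/\ orthant x, dotv (x - xs) (x - xs) < r ^+ 2 &
      f x - f xs < m * r ^+ 2] ->
  [/\ orthant x', dotv (x' - xs) (x' - xs) < r ^+ 2,
      f x' - f xs < m * r ^+ 2 &
      active x' delta = A /\ active x' 0 = A].
Proof.
have /andP[z0 z1] := zeta_bounds; have /andP[rho0 rho1] := rho_bounds.
have [mu mu0 [r1 r10 posH]] := hess_positive_near f_C2 xs_sosc.
have [c c0 [r2 r20 gA]] := grad_active_near.
have [m m0 [r3 r30 growth]] := quadratic_growth.
have L1 : 0 < Lg + 1 by rewrite ltr_wpDl.
(* All steps up to amax are accepted, by line_search_cond_small with 1 / 2 in the
   place of 1 - rho. *)
pose amax := Num.min 1 (Num.min 1 (mu / 2) / (2 * (Lg + 1))).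
have amax0 : 0 < amax.
  by rewrite lt_min ltr01 divr_gt0 ?mulr_gt0 // lt_min ltr01 divr_gt0.
have amax1 : amax <= 1 by rewrite ge_min lexx.
(* |p| is at most K |x - xs| on the inactive block. *)
pose K := 2 * Lg / mu.
have K0 : 0 <= K by rewrite divr_ge0 ?mulr_ge0 // ltW.
have Kmu : mu / 2 * K = Lg by rewrite /K; field; rewrite gt_eqF.
clearbody K.
have K2 : 0 < 2 + 2 * K by rewrite ltr_pwDl // mulr_ge0.
pose r := Num.min (Num.min r1 r2) (Num.min (r3 / (2 + 2 * K))
            (Num.min (delta / (1 + K)) (zeta * amax * c))).
have r0 : 0 < r.
  have K1 : 0 < 1 + K by rewrite ltr_pwDl.
  have ac0 : 0 < zeta * amax * c by rewrite !mulr_gt0.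
  by rewrite !lt_min r10 r20 ac0 !divr_gt0.
have rr1 : r <= r1 by rewrite !ge_min lexx.
have rr2 : r <= r2 by rewrite !ge_min lexx !orbT.
have rr3 : (2 + 2 * K) * r <= r3.
  by rewrite mulrC -ler_pdivlMr // !ge_min lexx !orbT.
have rd : (1 + K) * r <= delta.
  by rewrite mulrC -ler_pdivlMr ?ltr_pwDl // !ge_min lexx !orbT.
have rc : r <= zeta * amax * c by rewrite !ge_min lexx !orbT.
clearbody r.
have rsq s : r <= s -> r ^+ 2 <= s ^+ 2.
  by move=> rs; rewrite ler_pXn2r // nnegrE ltW // (lt_le_trans r0).
have r_delta : r <= delta.
  by apply: le_trans rd; rewrite ler_peMl ?(ltW r0) // lerDl.
exists m => //; exists r => // eta x x' [p [j [dir cond fails x'E]]] [ox xn fx].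
have [eA eI] := active_near delta_lt delta_gt0 ox (lt_le_trans xn (rsq _ r_delta)).
have gAx i (iA : i \in A) := gA x i ox (lt_le_trans xn (rsq _ rr2)) iA.
have gA0 i (iA : i \in A) := le_trans (ltW c0) (gAx i iA).
have posHx z := posH x z (lt_le_trans xn (rsq _ rr1)).
have [pA desc pI] := local_direction_descent mu0 eA eI (hess_sym x f_C2) posHx dir.
have pK : \sum_(i in ~: A) p i 0 ^+ 2 <= K ^+ 2 * dotv (x - xs) (x - xs).
  have mu2 : 0 < (mu / 2) ^+ 2 by rewrite exprn_gt0 // divr_gt0.
  rewrite -(ler_pM2l mu2); apply: le_trans pI _.
  apply: le_trans (grad_off_active ox) _.
  by rewrite mulrA -exprMn Kmu.
have P0 : 0 <= \sum_(i in ~: A) p i 0 ^+ 2.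
  by apply: sumr_ge0 => i _; apply: sqr_ge0.
have pi_small i : i \notin A -> `|p i 0| <= delta.
  move=> iA; rewrite -(@ler_pXn2r _ 2) ?nnegrE ?(ltW delta_gt0) //.
  rewrite real_normK ?num_real //.
  apply: (@le_trans _ _ (\sum_(i in ~: A) p i 0 ^+ 2)).
    have iC : i \in ~: A by rewrite inE.
    rewrite (bigD1 i iC) /= lerDl.
    by apply: sumr_ge0 => k _; apply: sqr_ge0.
  apply: le_trans pK _; apply: (@le_trans _ _ (((1 + K) * r) ^+ 2)).
    rewrite exprMn; apply: ler_pM; rewrite ?sqr_ge0 ?dotv_ge0 ?(ltW xn) //.
    by rewrite ler_pXn2r ?nnegrE ?addr_ge0 // lerDr.
  by rewrite ler_pXn2r // nnegrE ?(ltW delta_gt0) // mulr_ge0 ?addr_ge0 // ltW.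
have stay i alpha : i \notin A -> 0 <= alpha <= 1 -> 0 <= x i 0 + alpha * p i 0.
  move=> iA /andP[al0 al1].
  have xi : delta < x i 0 by move: iA; rewrite -eA active_orthant // ltNge.
  have := pi_small i iA; rewrite ler_norml => /andP[p0 _].
  have ap : - delta <= alpha * p i 0.
    apply: (@le_trans _ _ (alpha * - delta)); last exact: ler_wpM2l.
    by rewrite mulrN lerN2 ler_piMl // ltW.
  by rewrite -lerBlDl sub0r; apply: le_trans ap; rewrite lerN2 ltW.
have small alpha : 0 <= alpha <= amax -> line_search_cond f rho delta x p alpha.
  move=> /andP[al0 al1].
  have lim : Lg * alpha <= (1 - rho) * Num.min 1 (mu / 2).
    have al2 : alpha <= Num.min 1 (mu / 2) / (2 * (Lg + 1)).
      by apply: le_trans al1 _; rewrite /amax ge_min lexx orbT.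
    apply: (@le_trans _ _ ((Lg + 1) * (Num.min 1 (mu / 2) / (2 * (Lg + 1))))).
      by apply: ler_pM => //; rewrite lerDl.
    have min0 : 0 <= Num.min 1 (mu / 2) by rewrite le_min ler01 ltW // divr_gt0.
    move: (Num.min _ _) min0 => M M0.
    have -> : (Lg + 1) * (M / (2 * (Lg + 1))) = 2^-1 * M.
      by field; rewrite gt_eqF.
    by apply: ler_wpM2r => //; lra.
  have rho2 : 0 <= 1 - rho by lra.
  apply: (line_search_cond_small (L := Lg) (mu := mu) (A := A)) => //.
  - by move=> i iA; apply: stay => //; rewrite al0 (le_trans al1).
  - lra.
  - apply: le_trans lim _; rewrite ler_piMr // ge_min lexx //.
  - by apply: le_trans lim _; apply: ler_wpM2l => //; rewrite ge_min lexx orbT.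
have /andP[al0 al1] : zeta * amax <= zeta ^+ j <= 1.
  by apply: step_size_lower_bound _ small fails; rewrite amax0.
set alpha := zeta ^+ j in cond x'E al0 al1.
have alpha0 : 0 <= alpha by apply: le_trans al0; rewrite mulr_ge0 // ltW.
have ox' : orthant x' by move=> i; rewrite x'E mxE le_max lexx orbT.
have x'I i : i \notin A -> x' i 0 = x i 0 + alpha * p i 0.
  move=> iA; rewrite x'E mxE [X in Num.max X]mxE [X in _ + X]mxE.
  by rewrite max_l // stay ?alpha0.
have xA i : i \in A -> x i 0 < r.
  move=> iA; rewrite -(@ltr_pXn2r _ 2) ?nnegrE ?(ltW r0) ?ox //.
  apply: le_lt_trans xn; have := sqr_le_dotv (x - xs) i.
  rewrite mxE [X in _ + X]mxE.
  by move: iA; rewrite active_xs => /eqP->; rewrite subr0.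
have x'A i : i \in A -> x' i 0 = 0.
  move=> iA; rewrite x'E mxE [X in Num.max X]mxE [X in _ + X]mxE max_r // pA //.
  rewrite mulrN subr_le0; apply: le_trans (ltW (xA i iA)) _.
  apply: le_trans rc _; apply: ler_pM => //; last exact: gAx.
    by rewrite mulr_ge0 // ltW.
  exact: ltW.
have decr : f x' <= f x.
  move: cond; rewrite /line_search_cond eA eI -x'E => cond.
  rewrite -subr_le0; apply: le_trans cond _.
  have -> : proj_orthant (subvec A x + alpha *: subvec A p) - subvec A x =
    subvec A (x' - x) by rewrite x'E; apply/colP => i; rewrite !mxE.
  rewrite !dotv_subvec -[leRHS]addr0; apply: lerD.
    rewrite mulr_ge0_le0 ?(ltW rho0) //; apply: sumr_le0 => i iA.
    rewrite mulr_ge0_le0 ?gA0 // mxE [X in _ + X]mxE x'A // sub0r oppr_le0.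
    exact: ox.
  rewrite mulr_ge0_le0 ?mulr_ge0 // ?(ltW rho0) //.
  rewrite -oppr_ge0; apply: le_trans desc.
  by rewrite mulr_ge0 // ltW // divr_gt0.
have dist : dotv (x' - xs) (x' - xs) <= (2 + 2 * K) ^+ 2 * dotv (x - xs) (x - xs).
  have q0 := dotv_ge0 (x - xs).
  apply: (@le_trans _ _ (2 * dotv (x - xs) (x - xs) +
                         2 * \sum_(i in ~: A) p i 0 ^+ 2)); last first.
    apply: (@le_trans _ _ ((2 + 2 * K ^+ 2) * dotv (x - xs) (x - xs))).
      by rewrite (mulrDl 2 (2 * K ^+ 2)) lerD2l -mulrA ler_pM2l.
    by apply: ler_wpM2r => //; have := sqr_ge0 K; nra.
  rewrite [in leRHS](eq_bigl (fun i => i \notin A)) => [|i]; last by rewrite inE.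
  rewrite [in leRHS]big_mkcond /= !mulr_sumr -big_split /=.
  apply: ler_sum => i _.
  have -> : (x' - xs) i 0 = x' i 0 - xs i 0 by rewrite [LHS]mxE [X in _ + X]mxE.
  have -> : (x - xs) i 0 = x i 0 - xs i 0 by rewrite [LHS]mxE [X in _ + X]mxE.
  have [iA|iA] /= := boolP (i \in A).
    rewrite x'A //; move: iA; rewrite active_xs => /eqP->.
    by rewrite !subr0 mulr0 mulr0 addr0 mulr_ge0 // -expr2 sqr_ge0.
  rewrite x'I // addrAC; apply: le_trans (_ : _ <= 2 * ((x i 0 - xs i 0) *
    (x i 0 - xs i 0)) + 2 * (alpha * p i 0) ^+ 2) _.
    exact: sqrD_le.
  rewrite lerD2l ler_pM2l // exprMn ler_piMl ?sqr_ge0 //.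
  by rewrite expr_le1.
have x'r3 : dotv (x' - xs) (x' - xs) < r3 ^+ 2.
  apply: le_lt_trans dist _.
  apply: (@lt_le_trans _ _ ((2 + 2 * K) ^+ 2 * r ^+ 2)).
    by rewrite ltr_pM2l // exprn_gt0.
  rewrite -exprMn ler_pXn2r // nnegrE; last exact: ltW.
  by rewrite mulr_ge0 // ltW.
have fx' : f x' - f xs < m * r ^+ 2 by apply: le_lt_trans fx; rewrite lerD2r.
have x'n : dotv (x' - xs) (x' - xs) < r ^+ 2.
  by rewrite -(ltr_pM2l m0); apply: le_lt_trans fx'; apply: growth.
split=> //.
have [eA' eI'] := active_near delta_lt delta_gt0 ox' (lt_le_trans x'n (rsq _ r_delta)).
split=> //; apply/setP => i; rewrite active_orthant //.
have [iA|iA] := boolP (i \in A); first by rewrite x'A // lexx.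
apply/negbTE; rewrite -ltNge; apply: lt_trans delta_gt0 _.
by move: iA; rewrite -eA' active_orthant // ltNge.
Qed.

End Step.
End LocalMinimum.

(** * Identification of the active set *)

Unset Implicit Arguments.

Theorem theorem3p13 (R : realType) (d : nat) (f : 'cV[R]_d -> R)
    (f_C2 : twice_continuously_differentiable f)
    (Lg : R) (Lg_ge0 : 0 <= Lg)
    (grad_lipschitz : forall x y : 'cV[R]_d, orthant x -> orthant y ->
       norm2 (grad f x - grad f y) <= Lg * norm2 (x - y))
    (xs : 'cV[R]_d) (xs_min : constrained_local_min f xs)
    (xs_inactive : inactive xs 0 <> finset.set0)
    (xs_nondegenerate : forall i, i \in active xs 0 -> 0 < grad f xs i 0)
    (xs_sosc : forall z : 'cV[R]_d, z <> 0 ->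
       (forall i, i \in active xs 0 -> z i 0 = 0) ->
       0 < dotv z (hess f xs *m z))
    (delta : R) (delta_gt0 : 0 < delta)
    (delta_lt : forall i, i \in inactive xs 0 -> delta < 2^-1 * xs i 0)
    (rho : R) (rho_bounds : 0 < rho < 2^-1)
    (zeta : R) (zeta_bounds : 0 < zeta < 1)
    (eta : nat -> R) (eta_gt0 : forall k, 0 < eta k) :
  exists2 Delta_actv : R, 0 < Delta_actv &
    forall x : nat -> 'cV[R]_d, local_phase f rho zeta eta delta x ->
    forall kbar : nat, ball2 xs Delta_actv (x kbar) ->
    forall k : nat, (kbar + 1 <= k)%N ->
      active (x k) delta = active (x k) 0 /\ active (x k) 0 = active xs 0.
Proof.
have [m m0 [r r0 step]] := identifying_neighbourhood f_C2 Lg_ge0 grad_lipschitz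
  xs_min xs_nondegenerate xs_sosc delta_gt0 delta_lt rho_bounds zeta_bounds.
have G0 : 0 < norm2 (grad f xs) + Lg + 1.
  by rewrite ltr_wpDl // addr_ge0 // norm2_ge0.
(* For |x - xs| < D <= 1 the descent lemma bounds f x - f xs by
   (|g| + L) |x - xs|. *)
pose D := Num.min r (Num.min 1 (m * r ^+ 2 / (norm2 (grad f xs) + Lg + 1))).
have D0 : 0 < D by rewrite !lt_min r0 ltr01 divr_gt0 // mulr_gt0 // exprn_gt0.
exists D => // x [x0 steps] kbar xk k hk.
have ox l : orthant (x l).
  case: l => [//|l]; have [p [j [_ _ _ ->]]] := steps l.
  by move=> i; rewrite mxE le_max lexx orbT.
pose W y := [/\ orthant y, dotv (y - xs) (y - xs) < r ^+ 2 &
               f y - f xs < m * r ^+ 2].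
have Wk : W (x kbar).
  split=> //.
    by rewrite -norm2_lt //; apply: lt_le_trans xk _; rewrite ge_min lexx.
  have f_diff z : differentiable f z by case: f_C2.
  have [oxs _] := xs_min; have n0 := norm2_ge0 (x kbar - xs).
  have n1 : norm2 (x kbar - xs) <= 1.
    by apply: ltW; apply: lt_le_trans xk _; rewrite !ge_min lexx orbT.
  have nD : norm2 (x kbar - xs) <= D by apply: ltW.
  apply: le_lt_trans (descent_lemma f_diff grad_lipschitz Lg_ge0 oxs (ox _)) _.
  apply: (@le_lt_trans _ _ ((norm2 (grad f xs) + Lg) * D)).
    apply: (@le_trans _ _ ((norm2 (grad f xs) + Lg) * norm2 (x kbar - xs))).
      rewrite mulrDl lerD ?dotv_le_norm2 //; apply: ler_wpM2l => //.
      by rewrite -sqr_norm2 expr2 ler_piMl.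
    by apply: ler_wpM2l => //; rewrite addr_ge0 // norm2_ge0.
  apply: (@lt_le_trans _ _ ((norm2 (grad f xs) + Lg + 1) * D)).
    by rewrite ltr_pM2r // ltrDl.
  by rewrite mulrC -ler_pdivlMr // !ge_min lexx !orbT.
have WS n : W (x (kbar + n)%N).
  elim: n => [|n IH]; first by rewrite addn0.
  by rewrite addnS; have [] := step _ _ _ (steps (kbar + n)%N) IH.
have [n ->] : exists n, k = (kbar + n).+1.
  by exists (k - kbar.+1)%N; rewrite -addSn subnKC // -addn1.
by have [_ _ _ [-> ->]] := step _ _ _ (steps (kbar + n)%N) (WS n).
Qed.
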